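(* Suppose that $D_1$ is twice continuously differentiable and has its global maximum at $t_1$, and its global minimum at $t_2$, where $t_1<t_2$. Suppose further that there is a unique point $t_1<s<t_2$ such that $D_1|_{]t_1,s[}$ is strictly concave, and $D_1|_{]s,t_2[}$ is strictly convex. Then $\mu_R=D_1(s)$ is the stochastic resonance point.
   Context: Potential: $U:\mathbb{R}_+\times\mathbb{R}\to\mathbb{R}$, $(t,x)\mapsto U(t,x)$, is 1-periodic in $t$ and is a double-well potential with time-independent critical points: for every $t$ the local minima of $U(t,\cdot)$ are $\pm1$ and its only saddle point (separating them) is $0$. Outside of $x\in\{0,\pm1\}$, $\frac{\partial U}{\partial x}$ is continuous in $(t,x)$. There are constants $K_1,K_2>0$ with $\sup_{t\ge0}\frac{\partial U}{\partial x}(t,x)\le -K_2$ for $x\le -K_1$ and $\inf_{t\ge0}\frac{\partial U}{\partial x}(t,x)\ge K_2$ for $x\ge K_1$. The associated diffusion $X$ solves $dX_t=-\frac{\partial U}{\partial x}\left(\frac tT,X_t\right)dt+\sqrt{2\varepsilon}\,dW_t$, $T=\exp(\mu/\varepsilon)$, $W$ a one-dimensional Brownian motion. Depth functions: $D_{i}(t)=U(t,0)-U(t,i)$, $i=\pm1$ (1-periodic in $t$). It is assumed that all local extrema of $D_1$ and $D_{-1}$ are global and that these functions are strictly monotone between their extrema; that there is a phase $\phi\in\,]0,1[$ with $D_{-1}(t)=D_1(t+\phi)$ for $t\ge0$; and that $D_i(0)>\inf_{t\ge0}\max_{j=\pm1}D_j(t)$ for $i=\pm1$. For $\mu\ge0$,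 $a^i_\mu=\inf\{t\ge0:D_i(t)\le\mu\}$, $i=\pm1$. The resonance interval is $I_R=\left]\max_{i=\pm1}\inf_{t\ge0}D_i(t),\ \inf_{t\ge0}\max_{i=\pm1}D_i(t)\right[$. Stochastic resonance point (definition): suppose that $I_R\ni\mu\mapsto\max_{i=\pm1}\{\mu-D_i(a^i_\mu-h)\}$ possesses a global minimum $\mu_R(h)$ (i.e. a global minimizer, for small $h>0$), and suppose further that $\mu_R=\lim_{h\to0}\mu_R(h)$ exists in $I_R$. Then $\mu_R$ is called the stochastic resonance point of the diffusion $X$ with time-periodic potential $U$.
   Formalization: That D_1(s) is the stochastic resonance point is proved when D_1(s) lies in I_R (it can fail to, e.g. for a cosine D_1); any resonance point is shown to equal D_1(s). The global maximum and minimum of D_1 are taken to be unique up to the period. *)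

(* Defs.v *)
From mathcomp Require Import all_boot all_order all_algebra.
From mathcomp Require Import all_classical all_reals all_analysis.

Set Implicit Arguments.
Unset Strict Implicit.
Unset Printing Implicit Defensive.

Import Order.TTheory GRing.Theory Num.Theory.
Import numFieldNormedType.Exports.

Local Open Scope classical_set_scope.
Local Open Scope ring_scope.

(* Functions on [0, +oo[ (potentials, depths) are total functions on R of which
   only the values at nonnegative times are constrained. *)
Definition Rplus (R : realType) : set R := [set t | 0 <= t].
Arguments Rplus : clear implicits.

Definition local_min_at (R : realType) (f : R -> R) (x : R) : Prop :=
  \forall y \near x, f x <= f y.

Definition local_max_at (R : realType) (f : R -> R) (x : R) : Prop :=
  \forall y \near x, f y <= f x.

Definition global_min_at (R : realType) (A : set R) (f : R -> R) (x : R) : Prop :=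
  A x /\ forall y, A y -> f x <= f y.

Definition global_max_at (R : realType) (A : set R) (f : R -> R) (x : R) : Prop :=
  A x /\ forall y, A y -> f y <= f x.

Definition strictly_convex_on (R : realType) (A : set R) (f : R -> R) : Prop :=
  forall x y l : R, A x -> A y -> x != y -> 0 < l < 1 ->
    f (l * x + (1 - l) * y) < l * f x + (1 - l) * f y.

Definition strictly_concave_on (R : realType) (A : set R) (f : R -> R) : Prop :=
  forall x y l : R, A x -> A y -> x != y -> 0 < l < 1 ->
    l * f x + (1 - l) * f y < f (l * x + (1 - l) * y).

(* For a 1-periodic function on [0, +oo[, one-sided regularity at 0 is
   regularity from the right at 1, so it is enough to consider t > 0. *)
Definition twice_continuously_differentiable (R : realType) (f : R -> R) : Prop :=
  forall t : R, 0 < t ->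
    [/\ derivable f t 1, derivable (derive1 f) t 1 & {for t, continuous (derive1n 2 f)}].

(* In dimension one the saddle separating the two wells is the unique local
   maximum of U(t, .).  The potential may have kinks at -1, 0 and 1. *)
Record double_well_potential (R : realType) (U : R -> R -> R) : Prop := {
  dwp_periodic : forall t x : R, 0 <= t -> U (t + 1) x = U t x ;
  dwp_minima : forall t : R, 0 <= t -> local_min_at (U t) = [set -1; 1] ;
  dwp_saddle : forall t : R, 0 <= t -> local_max_at (U t) = [set 0] ;
  dwp_derivable : forall t x : R, 0 <= t -> ~ [set -1; 0; 1] x ->
    derivable (U t) x 1 ;
  dwp_critical : forall t x : R, 0 <= t -> ~ [set -1; 0; 1] x ->
    derive1 (U t) x != 0 ;
  dwp_continuous :
    {within [set p : R * R | 0 <= p.1 /\ ~ [set -1; 0; 1] p.2],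
      continuous (fun p : R * R => derive1 (U p.1) p.2)} ;
  dwp_growth : exists K1 K2 : R, [/\ 0 < K1, 0 < K2,
    (forall x : R, x <= - K1 ->
      (ereal_sup [set (derive1 (U t) x)%:E | t in Rplus R] <= (- K2)%:E)%E) &
    (forall x : R, K1 <= x ->
      (K2%:E <= ereal_inf [set (derive1 (U t) x)%:E | t in Rplus R])%E)]
}.

Section Depth.
Variables (R : realType) (U : R -> R -> R).

(* D_i(t); the index i = 1 or i = -1 is the position of the well. *)
Definition depth (i t : R) : R := U t 0 - U t i.

Definition inf_depth (i : R) : R := inf [set depth i t | t in Rplus R].

Definition inf_max_depth : R :=
  inf [set Num.max (depth 1 t) (depth (-1) t) | t in Rplus R].

Definition resonance_interval : set R :=
  `]Num.max (inf_depth 1) (inf_depth (-1)), inf_max_depth[%classic.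

(* a^i_mu *)
Definition entrance_time (i mu : R) : R :=
  inf [set t | 0 <= t /\ depth i t <= mu].

(* Local extrema are taken at t > 0: the endpoint 0 of [0, +oo[ is not an
   extremum of the periodic function unless t = 1 is one. *)
Record depth_assumptions : Prop := {
  da_max_global : forall i t : R, i = 1 \/ i = -1 -> 0 < t ->
    local_max_at (depth i) t -> global_max_at (Rplus R) (depth i) t ;
  da_min_global : forall i t : R, i = 1 \/ i = -1 -> 0 < t ->
    local_min_at (depth i) t -> global_min_at (Rplus R) (depth i) t ;
  da_monotone : forall i a b : R, i = 1 \/ i = -1 -> 0 <= a -> a < b ->
    (forall t : R, a < t < b ->
      ~ local_max_at (depth i) t /\ ~ local_min_at (depth i) t) ->
    {in `[a, b] &, {homo depth i : x y / x < y}} \/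
    {in `[a, b] &, {homo depth i : x y /~ x < y}} ;
  da_phase : exists phi : R, 0 < phi < 1 /\
    forall t : R, 0 <= t -> depth (-1) t = depth 1 (t + phi) ;
  da_start : forall i : R, i = 1 \/ i = -1 -> inf_max_depth < depth i 0
}.

Definition resonance_objective (h mu : R) : R :=
  Num.max (mu - depth 1 (entrance_time 1 mu - h))
          (mu - depth (-1) (entrance_time (-1) mu - h)).

(* Membership of the limit in the resonance interval is a genuine restriction:
   for D_1(t) = c + cos(2 pi (t - tau)) the inflection value c lies above the
   interval, whatever the phase, and there is no resonance point. *)
Definition stochastic_resonance_point (muR : R) : Prop :=
  exists m : R -> R,
    [/\ (\forall h \near 0^'+,
          global_min_at resonance_interval (resonance_objective h) (m h)),
        m h @[h --> 0^'+] --> muR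
      & resonance_interval muR].

End Depth.

Definition concave_convex_split (R : realType) (f : R -> R) (t1 t2 s : R) : Prop :=
  [/\ t1 < s < t2, strictly_concave_on `]t1, s[%classic f
    & strictly_convex_on `]s, t2[%classic f].

(* The maximum (minimum) of a 1-periodic function is attained at t and, up to
   the period, only there. *)
Definition periodic_argmax (R : realType) (f : R -> R) (t : R) : Prop :=
  global_max_at (Rplus R) f t /\
  forall u, global_max_at (Rplus R) f u -> exists k : int, u = t + k%:~R.

Definition periodic_argmin (R : realType) (f : R -> R) (t : R) : Prop :=
  global_min_at (Rplus R) f t /\
  forall u, global_min_at (Rplus R) f u -> exists k : int, u = t + k%:~R.

(* Main.v *)
Require Import Defs.
From mathcomp Require Import all_boot all_order all_algebra.
From mathcomp Require Import all_classical all_reals all_analysis.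
From mathcomp Require Import ring lra.
Import Order.TTheory GRing.Theory Num.Theory.
Import numFieldNormedType.Exports.
Local Open Scope classical_set_scope.
Local Open Scope ring_scope.

(* The two depth functions are phase shifts of one periodic function [f], and for
   [mu] in the resonance interval both are first entered at level [mu] through
   the same falling branch of [f].  Writing [mu = f c], both terms of the
   objective equal [f c - f (c - h)].  Strict concavity makes this increment
   decrease in [c] while [c < s], strict convexity makes it increase once
   [s < c - h], so every minimizer lies in [[s, s + h]], and letting [h] tend to
   [0] squeezes the minimizing levels to [f s]. *)

(** * Infima, integers and strict concavity *)

Lemma inf_attained (R : realType) (A : set R) (x : R) :
  A x -> lbound A x -> inf A = x.
Proof.
move=> Ax lbx; apply/le_anti/andP; split; first by apply: ge_inf => //; exists x.
by apply: lb_le_inf => //; exists x.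
Qed.

Lemma intr_itv01F (R : realType) (k : int) : ~ (0 < (k%:~R : R) < 1).
Proof. by rewrite ltr0z ltrz1 gtz0_ge1 => /andP[/le_lt_trans H /H]; rewrite ltxx. Qed.

Lemma convex_opp_concave (R : realType) (A : set R) (f : R -> R) :
  strictly_convex_on A f -> strictly_concave_on A (fun x => - f x).
Proof.
move=> cvx x y l Ax Ay xy hl; have := cvx x y l Ax Ay xy hl.
by rewrite !mulrN; lra.
Qed.

(** Both [x] and [y - h] are convex combinations of [x - h] and [y], with complementary weights;
    adding the two concavity inequalities gives the claim without derivatives. *)
Lemma concave_increment (R : realType) (A : set R) (f : R -> R) (x y h : R) :
  strictly_concave_on A f -> 0 < h -> x < y -> A (x - h) -> A y ->
  f y - f (y - h) < f x - f (x - h).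
Proof.
move=> ccv h0 xy Axh Ay.
have d0 : 0 < y - x + h by lra.
have dn : y - x + h != 0 by rewrite gt_eqF.
set l := (y - x) / (y - x + h).
have l01 : 0 < l < 1.
  by rewrite divr_gt0 ?ltr_pdivrMr //=; lra.
have ne : x - h != y by rewrite lt_eqF //; lra.
have H1 := ccv _ _ l Axh Ay ne l01.
have l01' : 0 < 1 - l < 1 by lra.
have H2 := ccv _ _ (1 - l) Axh Ay ne l01'.
have E1 : l * (x - h) + (1 - l) * y = x by rewrite /l; field.
have E2 : (1 - l) * (x - h) + (1 - (1 - l)) * y = y - h by rewrite /l; field.
rewrite E1 in H1; rewrite E2 in H2.
by move: H1 H2; set a := f (x - h); set b := f y; lra.
Qed.

(** [x] is the midpoint of two points of the interval, and by strict concavity they cannot both have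
    values at least [f x]. *)
Lemma concave_itv_not_min (R : realType) (f : R -> R) (a b x : R) :
  strictly_concave_on `]a, b[ f -> a < x < b ->
  exists2 y, a < y < b & f y < f x.
Proof.
move=> ccv /andP[ax xb].
pose e := Num.min (x - a) (b - x) / 2.
have [e0 ea eb] : [/\ 0 < e, a < x - e & x + e < b].
  by rewrite /e; case: (leP (x - a) (b - x)) => ?; split; lra.
have [lt1|ge1] := ltP (f (x - e)) (f x); first by exists (x - e) => //; lra.
have [lt2|ge2] := ltP (f (x + e)) (f x); first by exists (x + e) => //; lra.
have A1 : `]a, b[%classic (x - e) by rewrite /= in_itv /=; lra.
have A2 : `]a, b[%classic (x + e) by rewrite /= in_itv /=; lra.
have ne : x - e != x + e by rewrite lt_eqF //; lra.
have h2 : 0 < (2^-1 : R) < 1 by lra.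
have := ccv _ _ 2^-1 A1 A2 ne h2.
have -> : 2^-1 * (x - e) + (1 - 2^-1) * (x + e) = x by field.
by lra.
Qed.

(** * Periodicity, entrance times and the monotone branches *)

Lemma periodic_shift (R : realType) (f : R -> R) :
  (forall t, 0 <= t -> f (t + 1) = f t) ->
  forall (k : int) t, 0 <= t -> 0 <= t + k%:~R -> f (t + k%:~R) = f t.
Proof.
move=> per.
have pern (n : nat) t : 0 <= t -> f (t + n%:R) = f t.
  move=> t0; elim: n => [|n IH]; first by rewrite addr0.
  by rewrite -natr1 addrA per ?IH // addr_ge0.
case=> n t t0 tk0; first exact: pern.
have -> : f t = f (t + (Negz n)%:~R + n.+1%:R); last by rewrite pern.
by rewrite NegzE mulrNz subrK.
Qed.

(* The period cell is cut at the minimum: a superlevel set of [f] is an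
   interval modulo 1, so starting from a phase [p] of high depth the sublevel
   sets are all entered through the same copy of the falling branch. *)
Lemma entrance_time_falling_branch (R : realType) (f : R -> R) (t1 t2 c0 p : R) :
  (forall t, 0 <= t -> f (t + 1) = f t) ->
  0 <= t1 -> t1 < c0 < t2 -> t2 < t1 + 1 ->
  {in `[t1, t2] &, {homo f : x y /~ x < y}} ->
  {in `[t2, t1 + 1] &, {homo f : x y / x < y}} ->
  0 <= p -> f c0 < f p ->
  exists2 k : int, p < c0 + k%:~R &
    forall c, c0 <= c -> c < t2 ->
      inf [set t | 0 <= t /\ f (t + p) <= f c] = c + k%:~R - p.
Proof.
move=> per t10 /andP[t1c0 c0t2] t21 dec inc p0 fp.
have sh := @periodic_shift R f per.
(* This choice puts [p - k] in [[t2 - 1, t2[], the period cell between two consecutive minima. *)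
pose k := Num.floor (p - t2) + 1.
have /andP[] := floor_itv (p - t2); rewrite -/k.
have -> : Num.floor (p - t2) = k - 1 by rewrite /k addrK.
rewrite intrB => k1 k2.
have dec' x y : t1 <= x -> x <= y -> y <= t2 -> f y <= f x.
  move=> t1x; rewrite le_eqVlt => /predU1P[->//|xy] yt2.
  by apply/ltW/dec; rewrite ?in_itv //=; lra.
have inc' x y : t2 <= x -> x <= y -> y <= t1 + 1 -> f x <= f y.
  move=> t2x; rewrite le_eqVlt => /predU1P[->//|xy] yt1.
  by apply/ltW/inc; rewrite ?in_itv //=; lra.
have fsh u : 0 <= u -> 0 <= u - k%:~R -> f u = f (u - k%:~R).
  by move=> u0 uk0; rewrite -(sh k (u - k%:~R)) ?subrK.
have fsh1 u : 0 <= u -> 0 <= u - k%:~R + 1 -> f u = f (u - k%:~R + 1).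
  move=> u0 uk0; rewrite -(sh (k - 1) (u - k%:~R + 1)) ?intrB //.
    by congr f; ring.
  by rewrite (_ : _ + (_ - _) = u) //; ring.
have pc : p < c0 + k%:~R.
  rewrite ltNge; apply/negP => cp; move: fp; rewrite (fsh p); [|lra|lra].
  by rewrite ltNge => /negP; apply; apply: dec'; lra.
exists k => // c c0c ct2; apply: inf_attained => /=.
  split; first by lra.
  by rewrite subrK sh //; lra.
move=> t /= [t0 ft]; rewrite leNgt; apply/negP => tc; move: ft; apply/negP.
rewrite -ltNge; have [ht|ht] := leP t1 (t + p - k%:~R).
  rewrite (fsh (t + p)); [|lra|lra].
  by apply: dec; rewrite ?in_itv //=; lra.
(* Here [p] and [t + p] both lie on the rising branch that ends at the maximum [t1 + k], so the
   depth is still at least [f p], which exceeds [f c0]. *)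
apply: (@le_lt_trans _ _ (f c0)); first by apply: dec'; lra.
apply: (lt_le_trans fp).
rewrite (fsh1 p); [|lra|lra].
rewrite (fsh1 (t + p)); [|lra|lra].
by apply: inc'; lra.
Qed.

(* A local extremum inside the branch would be global, hence an integer
   translate of [t1] or [t2]; if the branch were longer than a period, such a
   translate would contradict strict concavity or strict convexity. *)
Lemma monotone_branches (R : realType) (U : R -> R -> R) (t1 t2 s : R) :
  double_well_potential U -> depth_assumptions U ->
  periodic_argmax (depth U 1) t1 -> periodic_argmin (depth U 1) t2 ->
  t1 < t2 -> concave_convex_split (depth U 1) t1 t2 s ->
  [/\ t2 < t1 + 1, {in `[t1, t2] &, {homo depth U 1 : x y /~ x < y}} &
      {in `[t2, t1 + 1] &, {homo depth U 1 : x y / x < y}}].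
Proof.
move=> hU hD; set f := depth U 1.
have per t : 0 <= t -> f (t + 1) = f t.
  by move=> t0; rewrite /f /depth !(dwp_periodic hU).
have sh := @periodic_shift R f per.
move=> [[t10 max1] uniq1] [[t20 min2] uniq2] t12 [/andP[t1s st2] ccv cvx].
rewrite /Rplus /= in t10 max1 t20 min2.
(* Strict concavity on []t1, s[] yields two distinct values of [f], so its extreme values differ. *)
have f12 : f t2 < f t1.
  have [y /andP[y1 y2] fy] : exists2 y, t1 < y < s & f y < f ((t1 + s) / 2).
    by apply: concave_itv_not_min => //; lra.
  have y0 : 0 <= y by lra.
  have m0 : 0 <= (t1 + s) / 2 by lra.
  exact: le_lt_trans (min2 _ y0) (lt_le_trans fy (max1 _ m0)).
have t21 : t2 < t1 + 1.
  rewrite ltNge; apply/negP => t1t2.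
  (* The translate [t2 - k] of the minimum lies in []t1, t1 + 1[]. Left of [s] it is a minimum
     inside the concave part; otherwise [t1 + 1] is a maximum inside the convex part. *)
  pose k := Num.floor (t2 - t1).
  have /andP[] := floor_itv (t2 - t1); rewrite -/k intrD => k1 k2.
  have kp : 0 < k.
    by rewrite -(ltrD2r 1) add0r -(ltr_int R) intrD; lra.
  have k1' : 1 <= (k%:~R : R) by rewrite ler1z -gtz0_ge1.
  have sh2 : f (t2 - k%:~R) = f t2 by rewrite -(sh k (t2 - k%:~R)) ?subrK; lra.
  have ne : t2 - k%:~R != t1.
    by apply: contraTneq f12 => e; rewrite -sh2 e ltxx.
  have lt1 : t1 < t2 - k%:~R by rewrite lt_neqAle eq_sym ne /=; lra.
  have [lts|les] := ltP (t2 - k%:~R) s.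
    have [y /andP[y1 y2]] := @concave_itv_not_min R f t1 s (t2 - k%:~R) ccv
      ltac:(lra).
    by rewrite sh2 ltNge min2 //=; lra.
  have [y /andP[y1 y2]] := @concave_itv_not_min R _ s t2 (t1 + 1)
      (convex_opp_concave _ _ _ cvx) ltac:(lra).
  by rewrite per // ltrN2 ltNge max1 //=; lra.
have glmax t : 0 < t -> local_max_at f t -> exists k : int, t = t1 + k%:~R.
  by move=> t0 /(da_max_global hD (or_introl erefl) t0) /uniq1.
have glmin t : 0 < t -> local_min_at f t -> exists k : int, t = t2 + k%:~R.
  by move=> t0 /(da_min_global hD (or_introl erefl) t0) /uniq2.
split=> //.
  have [] := @da_monotone _ _ hD 1 t1 t2 (or_introl erefl) t10 t12.
  - move=> t tt; split.
      move=> /glmax[|k e]; [lra|].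
      by apply: (@intr_itv01F R k); lra.
    move=> /glmin[|k e]; [lra|].
    by apply: (@intr_itv01F R (- k)); rewrite intrN; lra.
  - move=> /(_ t1 t2); rewrite !in_itv /= => H.
    have : f t1 < f t2 by apply: H => //; lra.
    by lra.
  - by [].
have [] := @da_monotone _ _ hD 1 t2 (t1 + 1) (or_introl erefl) t20 t21.
- move=> t tt; split.
    move=> /glmax[|k e]; [lra|].
    by apply: (@intr_itv01F R k); lra.
  move=> /glmin[|k e]; [lra|].
  by apply: (@intr_itv01F R k); lra.
- by [].
- move=> /(_ (t1 + 1) t2); rewrite !in_itv /= => H.
  have : f (t1 + 1) < f t2 by apply: H => //; lra.
  by rewrite per //; lra.
Qed.

(** * Minimizers of the increment along the branch *)

Lemma convex_increment (R : realType) (A : set R) (f : R -> R) (x y h : R) :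
  strictly_convex_on A f -> 0 < h -> x < y -> A (x - h) -> A y ->
  f x - f (x - h) < f y - f (y - h).
Proof.
move=> /convex_opp_concave ccv h0 xy Axh Ay.
have := concave_increment _ _ _ _ _ _ ccv h0 xy Axh Ay.
by rewrite -!opprD ltrN2.
Qed.

(** Left of [s] a small move to the right lowers the increment, and right of [s + h] a small move to
    the left does. In between, the window [[x - h, x]] straddles [s] and neither curvature
    decides. *)
Lemma increment_argmin_localized (R : realType) (f : R -> R) (t1 s t2 a h x : R) :
  strictly_concave_on `]t1, s[ f -> strictly_convex_on `]s, t2[ f ->
  0 < h -> t1 <= a - h -> a < x < t2 ->
  (forall y, a < y < t2 -> f x - f (x - h) <= f y - f (y - h)) ->
  s <= x <= s + h.
Proof.
move=> ccv cvx h0 ah /andP[ax xt] xmin.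
rewrite !leNgt; apply/andP; split; apply/negP => hx.
  pose y := Num.min ((x + s) / 2) ((x + t2) / 2).
  have [xy ys yt] : [/\ x < y, y < s & y < t2].
    by rewrite /y lt_min !gt_min; split; lra.
  have := xmin y; rewrite leNgt => /(_ ltac:(lra)) /negP; apply.
  by apply: (concave_increment _ _ _ _ _ _ ccv) => //=; rewrite in_itv /=; lra.
pose y := Num.max ((x + a) / 2) ((x + (s + h)) / 2).
have [yx sy ay] : [/\ y < x, s + h < y & a < y].
  by rewrite /y gt_max !lt_max; split; lra.
have := xmin y; rewrite leNgt => /(_ ltac:(lra)) /negP; apply.
by apply: (convex_increment _ _ _ _ _ _ cvx) => //=; rewrite in_itv /=; lra.
Qed.

(** The open branch is not compact, so the minimum is taken over [[s - h, s + 2h]]. The increment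
    decreases before this interval and increases after it, which makes the minimum global. *)
Lemma increment_argmin_exists (R : realType) (f : R -> R) (t1 s t2 h : R) :
  {in `]t1, t2], continuous f} ->
  strictly_concave_on `]t1, s[ f -> strictly_convex_on `]s, t2[ f ->
  0 < h -> t1 < s - h - h -> s + h + h < t2 ->
  exists2 c, t1 + h < c < t2 &
    forall y, t1 + h < y < t2 -> f c - f (c - h) <= f y - f (y - h).
Proof.
move=> cont ccv cvx h0 t1s st2.
have [||c] := @EVT_min R (fun c => f c - f (c - h)) (s - h) (s + h + h).
- by lra.
- apply: continuous_in_subspaceT => c /set_mem /=; rewrite in_itv /= => hc.
  apply: cvgB; first by apply: cont; rewrite in_itv /=; lra.
  apply: (@continuous_comp _ _ _ (fun c : R => c - h)).
    by apply: cvgB; [exact: cvg_id|exact: cvg_cst].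
  by apply: cont; rewrite in_itv /=; lra.
rewrite in_itv /= => hc cmin; exists c; first by lra.
move=> y /andP[y1 y2]; have [ys|ys] := ltP y (s - h).
  apply: le_trans (cmin (s - h) _) _; first by rewrite in_itv /=; lra.
  by apply/ltW/(concave_increment _ _ _ _ _ _ ccv) => //=; rewrite in_itv /=; lra.
have [sy|ys'] := ltP (s + h + h) y; last by apply: cmin; rewrite in_itv /= ys.
apply: le_trans (cmin (s + h + h) _) _; first by rewrite in_itv /=; lra.
by apply/ltW/(convex_increment _ _ _ _ _ _ cvx) => //=; rewrite in_itv /=; lra.
Qed.

(** * From phases on the branch to levels *)

Lemma decreasing_image_oo (R : realType) (f : R -> R) (a b mu : R) :
  a < b -> {within `[a, b], continuous f} ->
  {in `[a, b] &, {homo f : x y /~ x < y}} ->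
  `]f b, f a[%classic mu <-> exists2 c, a < c < b & f c = mu.
Proof.
move=> ab cont dec; rewrite /= in_itv /=; split.
  move=> /andP[mu1 mu2].
  have [|c] := @IVT _ f a b mu (ltW ab) cont.
    by rewrite ge_min le_max (ltW mu1) (ltW mu2) orbT.
  rewrite in_itv /= => /andP[ac cb] fc; exists c => //.
  have na : a != c by apply: contraTneq mu2 => ->; rewrite fc ltxx.
  have nb : c != b by apply: contraTneq mu1 => <-; rewrite fc ltxx.
  by rewrite !lt_neqAle na nb ac cb.
move=> [c /andP[ac cb] <-].
by rewrite !dec // in_itv /= ?lexx !ltW // (lt_trans ac).
Qed.

Lemma branch_image (R : realType) (f : R -> R) (t1 t2 c0 mu : R) :
  {in `]t1, t2], continuous f} ->
  {in `[t1, t2] &, {homo f : x y /~ x < y}} ->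
  t1 < c0 -> c0 < t2 ->
  `]f t2, f c0[%classic mu <-> exists2 c, c0 < c < t2 & f c = mu.
Proof.
move=> cont dec t1c0 c0t2; apply: decreasing_image_oo => //.
  apply: continuous_in_subspaceT => c /set_mem /=; rewrite in_itv /= => hc.
  by apply: cont; rewrite in_itv /=; lra.
by move=> x y; rewrite !in_itv /= => hx hy; apply: dec; rewrite in_itv /=; lra.
Qed.

Lemma branch_argmin_exists (R : realType) (f : R -> R) (g : R -> R -> R)
  (t1 s t2 c0 h0 : R) :
  {in `]t1, t2], continuous f} ->
  {in `[t1, t2] &, {homo f : x y /~ x < y}} ->
  strictly_concave_on `]t1, s[ f -> strictly_convex_on `]s, t2[ f ->
  t1 < s -> s < t2 -> t1 < c0 -> c0 < t2 -> 0 < h0 ->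
  (forall h c, 0 < h < h0 -> c0 <= c < t2 -> g h (f c) = f c - f (c - h)) ->
  c0 < s ->
  exists m : R -> R, \forall h \near 0^'+,
    global_min_at `]f t2, f c0[ (g h) (m h).
Proof.
move=> cont dec ccv cvx t1s st2 t1c0 c0t2 h00 gE c0s.
have branch mu := branch_image _ _ _ _ _ mu cont dec t1c0 c0t2.
(* The minimizer is chosen for all small [h] at once; for other [h] the value 0 is a mere
   default. *)
have /choice[m mP] h : exists mu,
    (0 < h < h0 /\ h < c0 - t1) /\ (t1 < s - h - h /\ s + h + h < t2) ->
    global_min_at `]f t2, f c0[ (g h) mu.
  have [[[hh hc] [hs1 hs2]]|no] := pselect
    ((0 < h < h0 /\ h < c0 - t1) /\ (t1 < s - h - h /\ s + h + h < t2));
    last by exists 0 => /no.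
  have /andP[h_gt0 hh0] := hh.
  (* This minimizes over []t1 + h, t2[], which contains []c0, t2[]; since [c0 < s], localization
     puts [c] in the smaller interval. *)
  have [c ct cmin] := increment_argmin_exists _ _ _ _ _ _ cont ccv cvx h_gt0 hs1 hs2.
  have /andP[sc csh] : s <= c <= s + h.
    apply: (increment_argmin_localized _ _ _ _ _ _ _ _ ccv cvx h_gt0 _ ct cmin).
    by rewrite addrK.
  exists (f c) => _; split; first by apply/branch; exists c => //; lra.
  move=> mu /branch[y hy <-].
  rewrite !gE //; [|lra|lra].
  by apply: cmin; lra.
exists m; near=> h; apply: mP.
have h_gt0 : 0 < h by near: h; exact: nbhs_right_gt.
have hh0 : h < h0 by near: h; exact: nbhs_right_lt.
have h1 : h < c0 - t1 by near: h; apply: nbhs_right_lt; rewrite subr_gt0.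
have h2 : h < (s - t1) / 2 by near: h; apply: nbhs_right_lt; lra.
have h3 : h < (t2 - s) / 2 by near: h; apply: nbhs_right_lt; lra.
by rewrite h_gt0; split; split=> //; lra.
Unshelve. all: by end_near.
Qed.

(** Localization squeezes [m h] between [f (s + h)] and [f s]. Since [m] is an arbitrary choice of
    minimizers, this also yields uniqueness of the limit. *)
Lemma branch_argmin_cvg (R : realType) (f : R -> R) (g : R -> R -> R)
  (t1 s t2 c0 h0 : R) (m : R -> R) :
  {in `]t1, t2], continuous f} ->
  {in `[t1, t2] &, {homo f : x y /~ x < y}} ->
  strictly_concave_on `]t1, s[ f -> strictly_convex_on `]s, t2[ f ->
  t1 < s -> s < t2 -> t1 < c0 -> c0 < t2 -> 0 < h0 ->
  (forall h c, 0 < h < h0 -> c0 <= c < t2 -> g h (f c) = f c - f (c - h)) ->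
  (\forall h \near 0^'+, global_min_at `]f t2, f c0[ (g h) (m h)) ->
  m h @[h --> 0^'+] --> f s.
Proof.
move=> cont dec ccv cvx t1s st2 t1c0 c0t2 h00 gE mmin.
have branch mu := branch_image _ _ _ _ _ mu cont dec t1c0 c0t2.
have lim_r : s + h @[h --> (0 : R)] --> s.
  by rewrite -[X in _ --> X]addr0; apply: cvgD; [exact: cvg_cst|exact: cvg_id].
have conts : {for s, continuous f} by apply: cont; rewrite in_itv /= t1s ltW.
apply: (@squeeze_cvgr _ _ _ _ (fun h => f (s + h)) (fun=> f s)); last first.
- exact: cvg_cst.
- apply: cvg_at_right_filter.
  exact: (@cvg_comp _ _ _ (fun h => s + h) f _ _ _ lim_r conts).
near=> h.
have h_gt0 : 0 < h by near: h; exact: nbhs_right_gt.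
have hh0 : h < h0 by near: h; exact: nbhs_right_lt.
have h1 : h < c0 - t1 by near: h; apply: nbhs_right_lt; rewrite subr_gt0.
have h2 : h < t2 - s by near: h; apply: nbhs_right_lt; rewrite subr_gt0.
have [/branch[c hc <-] cmin] :
  global_min_at `]f t2, f c0[ (g h) (m h) by near: h.
have /andP[sc csh] : s <= c <= s + h.
  apply: (increment_argmin_localized _ _ _ _ _ _ _ _ ccv cvx h_gt0 _ hc).
    by lra.
  move=> y hy.
  have hh : 0 < h < h0 by rewrite h_gt0.
  have := cmin (f y); rewrite (gE _ c hh) ?(gE _ y hh); [|lra..].
  by apply; apply/branch; exists y.
have le x y : s <= x -> x <= y -> y < t2 -> f y <= f x.
  move=> sx; rewrite le_eqVlt => /predU1P[->//|xy] yt2.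
  by apply/ltW/dec; rewrite ?in_itv //=; lra.
by apply/andP; split; apply: le; lra.
Unshelve. all: by end_near.
Qed.

(** * The resonance objective along the falling branch *)

Lemma depth_before_entrance (R : realType) (U : R -> R -> R) (t1 t2 c0 i p : R) :
  (forall t, 0 <= t -> depth U 1 (t + 1) = depth U 1 t) ->
  0 <= t1 -> t1 < c0 < t2 -> t2 < t1 + 1 ->
  {in `[t1, t2] &, {homo depth U 1 : x y /~ x < y}} ->
  {in `[t2, t1 + 1] &, {homo depth U 1 : x y / x < y}} ->
  0 <= p -> (forall t, 0 <= t -> depth U i t = depth U 1 (t + p)) ->
  depth U 1 c0 < depth U i 0 ->
  exists2 h0, 0 < h0 & forall h c, 0 < h < h0 -> c0 <= c < t2 ->
    depth U i (entrance_time U i (depth U 1 c) - h) = depth U 1 (c - h).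
Proof.
move=> per t10 c0t t21 dec inc p0 ph; rewrite ph // add0r => fp.
have [k pc ent] :=
  entrance_time_falling_branch _ _ _ _ _ _ per t10 c0t t21 dec inc p0 fp.
(* The first bound keeps the time [c + k - p - h] nonnegative, the second keeps [c - h] right of
   [t1]. *)
exists (Num.min (c0 + k%:~R - p) (c0 - t1)); first by rewrite lt_min; lra.
move=> h c; rewrite lt_min => /andP[h0 /andP[hk ht]] /andP[c0c ct2].
have -> : entrance_time U i (depth U 1 c) = c + k%:~R - p.
  rewrite -(ent c c0c ct2); congr inf; apply/seteqP.
  by split=> t /= [t0]; [rewrite ph|rewrite -ph].
rewrite ph; last lra.
rewrite -(@periodic_shift R _ per k (c - h)); [|lra|lra].
by congr depth; ring.
Qed.

Lemma inf_depth_phase (R : realType) (U : R -> R -> R) (t2 i p : R) :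
  (forall t, 0 <= t -> depth U 1 (t + 1) = depth U 1 t) ->
  periodic_argmin (depth U 1) t2 -> 0 <= p <= 1 ->
  (forall t, 0 <= t -> depth U i t = depth U 1 (t + p)) ->
  inf_depth U i = depth U 1 t2.
Proof.
move=> per [[t20 min2] _] /andP[p0 p1] ph; rewrite /Rplus /= in t20 min2.
apply: inf_attained.
  (* [t2 - p] may be negative, so the minimum is taken one period later. *)
  exists (t2 + 1 - p); first by rewrite /Rplus /=; lra.
  by rewrite ph ?subrK ?per //; lra.
by move=> _ [t t0 <-]; rewrite /Rplus /= in t0; rewrite ph // min2 // addr_ge0.
Qed.

(** [c0] is the phase on the falling branch at which the depth equals [inf_max_depth U]. Both wells
    start above this level, so both terms of the maximum reduce to the same increment. *)
Lemma resonance_objective_branch (R : realType) (U : R -> R -> R) (t1 t2 s : R) :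
  double_well_potential U -> depth_assumptions U ->
  (forall t, 0 < t -> {for t, continuous (depth U 1)}) ->
  periodic_argmax (depth U 1) t1 -> periodic_argmin (depth U 1) t2 ->
  t1 < t2 -> concave_convex_split (depth U 1) t1 t2 s ->
  resonance_interval U !=set0 ->
  exists c0 h0 : R, [/\ t1 < c0 < t2, 0 < h0,
    resonance_interval U = `]depth U 1 t2, depth U 1 c0[%classic &
    forall h c, 0 < h < h0 -> c0 <= c < t2 ->
      resonance_objective U h (depth U 1 c) = depth U 1 c - depth U 1 (c - h)].
Proof.
move=> hU hD cont max1 min2 t12 hs [mu].
have [t21 dec inc] := monotone_branches _ _ _ _ _ hU hD max1 min2 t12 hs.
have per t : 0 <= t -> depth U 1 (t + 1) = depth U 1 t.
  by move=> t0; rewrite /depth !(dwp_periodic hU).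
have [phi [/andP[phi0 phi1] ph]] := da_phase hD.
have ph0 t : 0 <= t -> depth U 1 t = depth U 1 (t + 0) by rewrite addr0.
have I1 : inf_depth U 1 = depth U 1 t2.
  by apply: (inf_depth_phase _ _ _ _ 0) => //; rewrite lexx ler01.
have I2 : inf_depth U (-1) = depth U 1 t2.
  by apply: (inf_depth_phase _ _ _ _ phi) => //; rewrite !ltW.
have M1 := da_start hD (or_introl erefl : (1 : R) = 1 \/ _).
have M2 := da_start hD (or_intror erefl : (-1 : R) = 1 \/ _).
rewrite /resonance_interval /= in_itv /= I1 I2 maxxx => /andP[mu1 mu2].
have t10 : 0 <= t1 := max1.1.1.
have f1 : depth U 1 0 <= depth U 1 t1 by apply: max1.1.2; rewrite /Rplus /=.
have [c0] : exists2 c, c \in `[t1, t2] & depth U 1 (c + 1) = inf_max_depth U.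
  (* Possibly [t1 = 0], where the depth is continuous only from the right. *)
  apply: (@IVT _ (fun c => depth U 1 (c + 1))); first exact: ltW.
    apply: continuous_in_subspaceT => c /set_mem /=; rewrite in_itv /= => hc.
    apply: (@continuous_comp _ _ _ (fun c : R => c + 1)).
      by apply: cvgD; [exact: cvg_id|exact: cvg_cst].
    by apply: cont; lra.
  rewrite !per //; last lra.
  by rewrite ge_min le_max; lra.
rewrite in_itv /= => c0t; rewrite per; last lra.
move=> fc0.
have c0t' : t1 < c0 < t2.
  have n1 : c0 != t1 by apply: contra_eq_neq fc0 => ->; rewrite gt_eqF //; lra.
  have n2 : c0 != t2 by apply: contra_eq_neq fc0 => ->; rewrite lt_eqF //; lra.
  by move: c0t; rewrite !le_eqVlt (negPf n2) eq_sym (negPf n1).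
rewrite -fc0 in M1 M2 *.
have [h1 h10 H1] :=
  depth_before_entrance _ _ _ _ _ _ _ per t10 c0t' t21 dec inc (lexx 0) ph0 M1.
have [h2 h20 H2] :=
  depth_before_entrance _ _ _ _ _ _ _ per t10 c0t' t21 dec inc (ltW phi0) ph M2.
exists c0, (Num.min h1 h2); split=> //; first by rewrite lt_min h10.
move=> h c; rewrite lt_min => /andP[h0 /andP[hh1 hh2]] hc.
by rewrite /resonance_objective H1 ?H2 ?maxxx // ?h0.
Qed.

(** * Existence and uniqueness of the resonance point *)

Theorem theorem3p2 (R : realType) (U : R -> R -> R)
    (hU : double_well_potential U)
    (hD : depth_assumptions U)
    (hC2 : twice_continuously_differentiable (depth U 1))
    (t1 t2 s : R)
    (ht1 : periodic_argmax (depth U 1) t1)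
    (ht2 : periodic_argmin (depth U 1) t2)
    (ht12 : t1 < t2)
    (hs : concave_convex_split (depth U 1) t1 t2 s)
    (hs_unique : forall s' : R,
       concave_convex_split (depth U 1) t1 t2 s' -> s' = s) :
  (resonance_interval U (depth U 1 s) ->
     stochastic_resonance_point U (depth U 1 s)) /\
  (forall mu : R, stochastic_resonance_point U mu -> mu = depth U 1 s).
Proof.
have cont t : 0 < t -> {for t, continuous (depth U 1)}.
  by move=> /hC2[/derivable1_diffP /differentiable_continuous].
have [t21 dec _] := monotone_branches _ _ _ _ _ hU hD ht1 ht2 ht12 hs.
have [/andP[t1s st2] ccv cvx] := hs.
have contI : {in `]t1, t2], continuous (depth U 1)}.
  move=> t; rewrite in_itv /= => /andP[t1t _].
  exact/cont/le_lt_trans/t1t/ht1.1.1.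
have branch muI :=
  resonance_objective_branch _ _ _ _ _ hU hD cont ht1 ht2 ht12 hs muI.
split.
  move=> sI; have [c0 [h0 [/andP[t1c0 c0t2] h00 IE objE]]] := branch (ex_intro _ _ sI).
  have c0s : c0 < s.
    rewrite ltNge; apply/negP; rewrite le_eqVlt => sc0.
    move: (sI); rewrite IE /= in_itv /= => /andP[_].
    case/predU1P: sc0 => [->|sc0]; first by rewrite ltxx.
    by rewrite ltNge ltW // dec // in_itv /= !ltW // (lt_trans t1s).
  have [m mmin] := branch_argmin_exists _ _ _ _ _ _ _ _ contI dec ccv cvx
    t1s st2 t1c0 c0t2 h00 objE c0s.
  exists m; split=> //; first by rewrite IE.
  exact: (branch_argmin_cvg _ _ _ _ _ _ _ _ _ contI dec ccv cvx
    t1s st2 t1c0 c0t2 h00 objE).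
(* A resonance point makes the interval nonempty, and its minimizers also converge to the depth at
   [s]. *)
move=> mu [m [mmin mcvg muI]].
have [c0 [h0 [/andP[t1c0 c0t2] h00 IE objE]]] := branch (ex_intro _ _ muI).
rewrite IE in mmin; have := branch_argmin_cvg _ _ _ _ _ _ _ _ _ contI dec ccv cvx
  t1s st2 t1c0 c0t2 h00 objE mmin.
exact: cvg_unique mcvg.
Qed.
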